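(* Let $k$ be a positive integer. If $B_1,\ldots,B_k$ are finite, non-empty subsets of a vector space $V$ over a field of characteristic zero, then $$|B_1^\ast+\dots+B_k^\ast|\ge 2^{\operatorname{rk}(B_1)}\,(3/2)^{\operatorname{rk}(B_2)}\cdots((k+1)/k)^{\operatorname{rk}(B_k)}.$$ In particular, if $\dim V=n$ and $B_1,\ldots,B_k$ are bases of $V$, then $|B_1^\ast+\dots+B_k^\ast|\ge(k+1)^n$.
   Context: For a subset $B$ of a vector space, $B^\ast=\{\sum_{a\in A}a: A\subseteq B,\ A \text{ finite}\}$ is its subset sum set (including the empty sum $0$), $\operatorname{rk}(B)$ is the dimension of the linear span of $B$, and $B_1+\dots+B_k=\{b_1+\dots+b_k: b_i\in B_i\}$ is the sumset. (The paper says ''field of infinite characteristic'', meaning characteristic zero.) *)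

(* Defs.v *)
From HB Require Import structures.
From mathcomp Require Import all_boot all_order all_algebra.
From mathcomp Require Import finmap.
From mathcomp Require Import boolp classical_sets functions cardinality.

Set Implicit Arguments.
Unset Strict Implicit.
Unset Printing Implicit Defensive.

Import Order.TTheory GRing.Theory Num.Theory.
Local Open Scope fset_scope.
Local Open Scope classical_set_scope.
Local Open Scope card_scope.
Local Open Scope ring_scope.

(* V is not assumed finite-dimensional, so subspaces are plain sets of vectors
   rather than {vspace V}. *)
Section LinearAlgebra.
Variables (F : fieldType) (V : lmodType F).
Implicit Types (A : {fset V}) (B C U : set V) (c : V -> F).

Definition lspan B : set V :=
  [set x | exists A c, [set` A] `<=` B /\ x = \sum_(a <- A) c a *: a].

Definition lfree B : Prop :=
  forall A c, [set` A] `<=` B -> \sum_(a <- A) c a *: a = 0 ->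
    forall a, a \in A -> c a = 0.

Definition is_basis U B : Prop := lfree B /\ lspan B = U.

Definition has_dim U (n : nat) : Prop :=
  exists B, is_basis U B /\ B #= `I_n.

(* The value is 0 when U has no finite basis; by [has_dim_rk] and
   [has_dim_unique] below this never concerns the rank of a finite set. *)
Definition ldim U : nat := xget 0%N [set n | has_dim U n].

Definition rk B : nat := ldim (lspan B).

Definition subset_sums B : set V :=
  [set x | exists A, [set` A] `<=` B /\ x = \sum_(a <- A) a].

Definition sumset (k : nat) (S : 'I_k -> set V) : set V :=
  [set x | exists b : 'I_k -> V, (forall i, S i (b i)) /\ x = \sum_i b i].

Lemma finite_subset_sums B : finite_set B -> finite_set (subset_sums B).
Proof.
move=> finB.
apply: (@sub_finite_set _ _
  ((fun A => \sum_(a <- A) a) @` [set` fpowerset (fset_set B)])).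
  move=> _ [A [AB ->]]; exists A => //=; rewrite fpowersetE.
  by apply/fsubsetP => a /AB Ba; rewrite in_fset_set// inE.
exact/finite_image/finite_fset.
Qed.

Lemma finite_sumset k (S : 'I_k -> set V) :
  (forall i, finite_set (S i)) -> finite_set (sumset S).
Proof.
move=> finS; pose X := \bigcup_(i in [set: 'I_k]) S i.
have finX : finite_set X by apply: bigcup_finite => //; exact: finite_finset.
apply: (@sub_finite_set _ _
  ((fun f : {ffun 'I_k -> fset_set X} => \sum_i val (f i)) @` setT)).
  move=> _ [b [bS ->]].
  have bX i : b i \in fset_set X by rewrite in_fset_set// inE; exists i.
  exists [ffun i => [` bX i]] => //.
  by apply: eq_bigr => i _; rewrite ffunE.
exact/finite_image/finite_finset.
Qed.

Lemma sub_sum_fset A A' c : (A `<=` A')%fset ->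
  \sum_(a <- A) c a *: a = \sum_(a <- A') (if a \in A then c a else 0) *: a.
Proof.
move=> sAA'; rewrite -(big_fset_incl _ sAA').
  by rewrite !big_seq; apply: eq_bigr => a ->.
by move=> a _ /negPf ->; rewrite scale0r.
Qed.

Lemma lspan_fset A x :
  lspan [set` A] x <-> exists c, x = \sum_(a <- A) c a *: a.
Proof.
split=> [[A' [c [sA ->]]]|[c ->]]; last by exists A; exists c; split.
by exists (fun a => if a \in A' then c a else 0); apply/sub_sum_fset/fsubsetP.
Qed.

Lemma lfree_fset A : lfree [set` A] <->
  forall c, \sum_(a <- A) c a *: a = 0 -> forall a, a \in A -> c a = 0.
Proof.
split=> [h c|h A' c sA]; first by apply: h.
have {}sA : (A' `<=` A)%fset by apply/fsubsetP.
rewrite (sub_sum_fset _ sA) => /h + a aA' => /(_ a).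
by rewrite aA'; apply; apply: (fsubsetP sA).
Qed.

Lemma sub_lspan B : B `<=` lspan B.
Proof.
move=> b Bb; exists [fset b], (fun=> 1); split=> [a /=|].
  by rewrite inE => /eqP ->.
by rewrite big_seq_fset1 scale1r.
Qed.

Lemma lspanS B C : B `<=` C -> lspan B `<=` lspan C.
Proof. by move=> BC x [A [c [AB ->]]]; exists A, c; split=> // a /AB/BC. Qed.

Lemma lspan_fset_sub B A : B `<=` lspan [set` A] -> lspan B `<=` lspan [set` A].
Proof.
move=> BA x [A' [c [A'B ->]]]; apply/lspan_fset.
have /choice[d dE] (a : V) : exists d : V -> F,
    a \in A' -> a = \sum_(y <- A) d y *: y.
  have [aA'|_] := boolP (a \in A'); last by exists (fun=> 0).
  by have /lspan_fset[d ?] := BA _ (A'B _ aA'); exists d.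
exists (fun y => \sum_(a <- A') c a * d a y).
rewrite big_seq; under eq_bigr => a aA' do rewrite {2}(dE _ aA') scaler_sumr.
rewrite -big_seq exchange_big /=; apply: eq_bigr => y _.
by rewrite scaler_suml; apply: eq_bigr => a _; rewrite scalerA.
Qed.

Lemma leq_lfree_lspan A A' :
  lfree [set` A] -> [set` A] `<=` lspan [set` A'] -> (#|` A| <= #|` A'|)%N.
Proof.
move=> /lfree_fset freeA AA'.
have /choice[d dE] (a : A) : exists d : V -> F,
    val a = \sum_(y <- A') d y *: y by apply/lspan_fset/AA'/valP.
pose M := \matrix_(i < #|{: A}|, j < #|{: A'}|)
  d (enum_val i) (val (enum_val j)).
suff : row_free M.
  by rewrite !cardfE -row_leq_rank => /leq_trans; apply; exact: rank_leq_col.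
rewrite -kermx_eq0; apply/rowV0P => v /sub_kermxP vM.
pose c (x : V) := if insub x is Some a then v 0 (enum_rank (a : A)) else 0.
have cE (a : A) : c (val a) = v 0 (enum_rank a) by rewrite /c valK.
suff c0 : \sum_(a <- A) c a *: a = 0.
  apply/rowP => i; rewrite mxE -[i]enum_valK -cE.
  by apply: (freeA c c0); exact: valP.
rewrite big_seq_fsetE /=.
under eq_bigr => a _ do rewrite cE dE scaler_sumr.
rewrite exchange_big /= big_seq_fsetE /= big1// => y _.
under eq_bigr => a _ do rewrite scalerA.
rewrite -scaler_suml.
have := congr1 (fun w : 'rV_ _ => w 0 (enum_rank y)) vM.
rewrite !mxE (reindex_onto enum_rank enum_val) /=; last first.
  by move=> i _; rewrite enum_valK.
under eq_bigl do rewrite enum_rankK eqxx.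
under eq_bigr do rewrite mxE !enum_rankK.
by move=> ->; rewrite scale0r.
Qed.

Lemma has_dimP U n : has_dim U n <->
  exists A, [/\ lfree [set` A], lspan [set` A] = U & #|` A| = n].
Proof.
split=> [[B [[freeB spanB] cardB]]|[A [freeA spanA cardA]]]; last first.
  by exists [set` A]; split=> //; exact/card_eq_fsetP.
have finB : finite_set B by apply/finite_setP; exists n.
by exists (fset_set B); rewrite fset_setK//; split=> //; exact: card_fset_set.
Qed.

Lemma has_dim_unique U m n : has_dim U m -> has_dim U n -> m = n.
Proof.
move=> /has_dimP[A [fA sA <-]] /has_dimP[A' [fA' sA' <-]].
apply/eqP; rewrite eqn_leq; apply/andP; split; apply: leq_lfree_lspan => //.
- by rewrite sA' -sA; exact: sub_lspan.
- by rewrite sA -sA'; exact: sub_lspan.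
Qed.

Lemma has_dim_rk B : finite_set B -> has_dim (lspan B) (rk B).
Proof.
move=> finB; apply: (@xgetPex _ 0%N [set n | has_dim (lspan B) n]).
pose P n := `[< exists A, [/\ [set` A] `<=` B, lfree [set` A] & #|` A| = n] >].
have exP : exists n, P n.
  by exists 0%N; apply/asboolP; exists fset0; split=> //; apply/lfree_fset.
have leP n : P n -> (n <= #|` fset_set B|)%N.
  move=> /asboolP[A [AB _ <-]]; apply/fsubset_leq_card/fsubsetP => a /AB Ba.
  by rewrite in_fset_set// inE.
case: (ex_maxnP exP leP) => n /asboolP[A [AB freeA cardA]] maxn.
exists n; apply/has_dimP; exists A; split=> //.
apply/seteqP; split; first exact: lspanS.
apply: lspan_fset_sub => b Bb; apply: contrapT => nAb.
have bA : b \notin A by apply/negP => /(@sub_lspan [set` A]).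
suff /maxn : P n.+1 by rewrite ltnn.
apply/asboolP; exists (b |` A)%fset; split.
- by move=> a /=; rewrite !inE => /orP[/eqP ->//|/AB].
- apply/lfree_fset => c; rewrite big_fsetU1//= => c0.
  have cb : c b = 0.
    apply/eqP/negP => /negP cb; apply: nAb; apply/lspan_fset.
    exists (fun a => - (c b)^-1 * c a).
    under eq_bigr do rewrite -scalerA.
    rewrite -scaler_sumr -[\sum_(a <- A) _](addKr (c b *: b)) c0 addr0.
    by rewrite scalerN scaleNr opprK scalerA mulVf// scale1r.
  move=> a; rewrite !inE => /orP[/eqP ->//|]; move/lfree_fset : freeA; apply.
  by move: c0; rewrite cb scale0r add0r.
- by rewrite cardfsU1 bA cardA.
Qed.

End LinearAlgebra.

(* Main.v *)
Require Import Defs.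
From HB Require Import structures.
From mathcomp Require Import all_boot all_order all_algebra.
From mathcomp Require Import finmap.
From mathcomp Require Import boolp classical_sets functions cardinality.

(* In characteristic 0, every line in direction b <> 0 that meets a finite set A
   gains a point in A + {0, b}, so |A + {0, b}| >= |A| + |phi(A)| whenever
   phi is linear with phi b = 0. Take phi with kernel spanned by b, so that
   ranks drop by at most one, and induct on k and on the number of vectors of
   B_k: passing to the quotient divides the bound for B_1, ..., B_(k-1) by at most
   2 * (3/2) * ... * (k/(k-1)) = k, hence each unit of rk B_k contributes a
   factor 1 + 1/k. *)

Set Implicit Arguments.
Unset Strict Implicit.
Unset Printing Implicit Defensive.

Import Order.TTheory GRing.Theory Num.Theory.
Local Open Scope fset_scope.
Local Open Scope classical_set_scope.
Local Open Scope ring_scope.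

(** * Subset sums built one vector at a time *)

Definition add_vec {V : zmodType} (b : V) (A : {fset V}) : {fset V} :=
  (A `|` [fset (a + b)%R | a in A])%fset.

(** Lists rather than sets: a linear image of the data may repeat vectors or contain 0, and still
    has this form. *)
Fixpoint list_sums {V : zmodType} (L : nat -> seq V) (k : nat) : {fset V} :=
  if k is k'.+1 then foldr add_vec (list_sums L k') (L k') else [fset 0].

(** * Growth of a finite set under one translation *)

Section Translates.
Variables (F : fieldType) (charF : [pchar F] =i pred0).

(** In characteristic 0 the points [a + b *+ n] are pairwise distinct, so the walk from [a] must
    leave the finite set [A]. *)
Lemma exists_translate_notin (V : lmodType F) (A : {fset V}) (a b : V) :
  b != 0 -> a \in A -> exists n, a + b *+ n \in A /\ a + b *+ n.+1 \notin A.
Proof.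
move=> b0 aA; apply: contrapT => noexit.
have stay n : a + b *+ n \in A.
  elim: n => [|n IHn]; first by rewrite mulr0n addr0.
  by apply: contrapT => /negP nA; apply: noexit; exists n.
have inj : injective (fun n => a + b *+ n).
  move=> m n /addrI /eqP; wlog mn : m n / (m <= n)%N => [th|].
    by case/orP: (leq_total m n) => [/th//|/th + /eqP/esym/eqP] => /[apply].
  rewrite eq_sym -subr_eq0 -mulrnBr// -scaler_nat scaler_eq0 (negPf b0) orbF.
  rewrite (proj1 (pcharf0P F) charF) subn_eq0 => nm.
  by apply/eqP; rewrite eqn_leq mn.
have : (size [seq (a + b *+ n)%R | n <- iota 0 #|` A|.+1] <= #|` A|)%N.
  apply: uniq_leq_size; first by rewrite map_inj_uniq ?iota_uniq.
  by move=> _ /mapP[n _ ->].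
by rewrite size_map size_iota ltnn.
Qed.

Lemma card_add_vec (V W : lmodType F) (phi : {linear V -> W}) (b : V)
    (A : {fset V}) : b != 0 -> phi b = 0 ->
  (#|` A| + #|` [fset phi a | a in A]| <= #|` add_vec b A|)%N.
Proof.
move=> b0 phib; rewrite /add_vec -[X in (_ <= X)%N](cardfsID A).
have -> : ((A `|` [fset (a + b)%R | a in A]) `&` A = A)%fset.
  by apply/fsetIidPr; exact: fsubsetUl.
rewrite leq_add2l; set D := (_ `\` A)%fset.
(* [phi] maps the new points [D] onto [phi(A)]: the walk from [a] exits at a point of [D] with the
   same image, as [phi b = 0]. *)
apply: leq_trans (leq_imfset_card (imfset_key) phi (mem D)).
apply/fsubset_leq_card/fsubsetP => _ /imfsetP[/= a aA ->].
have [n [nA nA']] := exists_translate_notin b0 aA.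
apply/imfsetP; exists (a + b *+ n.+1) => /=.
  rewrite !inE nA' /=; apply/orP; right; apply/imfsetP.
  by exists (a + b *+ n) => //=; rewrite mulrSr addrA.
by rewrite linearD linearMn phib mul0rn addr0.
Qed.

End Translates.

Lemma imfset_add_vec (V W : zmodType) (phi : {additive V -> W}) b
    (A : {fset V}) :
  [fset phi a | a in add_vec b A] = add_vec (phi b) [fset phi a | a in A].
Proof.
rewrite /add_vec imfsetU; congr (_ `|` _)%fset.
apply/fsetP => x; apply/imfsetP/imfsetP => /= [[_ /imfsetP[/= a aA ->] ->]|].
  by exists (phi a); rewrite ?raddfD//; apply/imfsetP; exists a.
move=> [_ /imfsetP[/= a aA ->] ->]; exists (a + b); rewrite ?raddfD//.
by apply/imfsetP; exists a.
Qed.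

Lemma imfset_foldr_add_vec (V W : zmodType) (phi : {additive V -> W})
    (A : {fset V}) s :
  [fset phi a | a in foldr add_vec A s] =
  foldr add_vec [fset phi a | a in A] (map phi s).
Proof. by elim: s => //= b s <-; rewrite imfset_add_vec. Qed.

Lemma imfset_list_sums (V W : zmodType) (phi : {additive V -> W}) L k :
  [fset phi a | a in list_sums L k] = list_sums (map phi \o L) k.
Proof.
elim: k => [|k IHk] /=; last by rewrite imfset_foldr_add_vec IHk.
by apply/fsetP => x; rewrite imfset_fset1 raddf0.
Qed.

Lemma prod_succ_ratio k :
  \prod_(i < k) (i.+2%:R / i.+1%:R) = k.+1%:R :> rat.
Proof.
elim: k => [|k IHk]; first by rewrite big_ord0.
by rewrite big_ord_recr /= IHk mulrCA mulfV ?pnatr_eq0// mulr1.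
Qed.

Lemma succ_ratio_ge1 i : 1 <= i.+2%:R / i.+1%:R :> rat.
Proof. by rewrite ler_pdivlMr ?ltr0n// mul1r ler_nat. Qed.

(** * Quotient by a line, realised as a projection *)

Section Quotient.
Variables (F : fieldType) (vT : vectType F).
Implicit Types (b : vT) (U : {vspace vT}).

(** Stands for the quotient map by the line of [b], but as an endomorphism, so that the induction
    stays inside [vT]. *)
Definition quo_line b : 'End(vT) := (\1 - projv <[b]>)%VF.

Lemma quo_lineE b x : quo_line b x = x - projv <[b]> x.
Proof. by rewrite !lfunE /= !lfunE. Qed.

Lemma quo_line_id b : quo_line b b = 0.
Proof. by rewrite quo_lineE projv_id ?memv_line// subrr. Qed.

Lemma dim_quo_line b U : (\dim U <= (\dim (quo_line b @: U)).+1)%N.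
Proof.
rewrite -(limg_ker_dim (quo_line b) U) addnC -addn1 leq_add2l.
have sub_line : (U :&: lker (quo_line b) <= <[b]>)%VS.
  apply/subvP => x /memv_capP[_]; rewrite memv_ker quo_lineE subr_eq0.
  by move=> /eqP ->; exact: memv_proj.
by rewrite (leq_trans (dimvS sub_line))// dim_vline leq_b1.
Qed.

End Quotient.

(** * The bound for lists in a finite-dimensional space *)

Section ListSums.
Variables (F : fieldType) (charF : [pchar F] =i pred0) (vT : vectType F).

Local Notation w i := (i.+2%:R / i.+1%:R : rat).
Local Notation bound L k := (\prod_(i < k) w i ^+ \dim <<L i>>%VS).

(** Each rank drops by at most one, so factor [i] loses at most [w i]; these losses telescope to
    [k.+1]. *)
Lemma bound_quo_line k (L : nat -> seq vT) b :
  bound L k <= k.+1%:R * bound (map (quo_line b) \o L) k.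
Proof.
rewrite -prod_succ_ratio -big_split /=; apply: ler_prod => i _.
rewrite exprn_ge0 ?(le_trans ler01 (succ_ratio_ge1 _))//= -exprS.
by rewrite ler_weXn2l ?succ_ratio_ge1// -limg_span dim_quo_line.
Qed.

Lemma card_foldr_add_vec k (L : nat -> seq vT) s :
  (forall L' : nat -> seq vT, bound L' k <= #|` list_sums L' k|%:R) ->
  bound L k * w k ^+ \dim <<s>>%VS <=
    #|` foldr add_vec (list_sums L k) s|%:R.
Proof.
move=> IHk; have bound_ge0 (L' : nat -> seq vT) : 0 <= bound L' k.
  apply: prodr_ge0 => i _.
  by rewrite exprn_ge0// (le_trans ler01)// succ_ratio_ge1.
(* Induction on the length, since the hypothesis is needed both for the tail and for its
   projection. *)
have [m sm] := ubnP (size s); elim: m => // m IHm in s sm L *.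
case: s sm => [|b s] /=; first by rewrite span_nil dimv0 expr0 mulr1.
rewrite ltnS => sm; have IHs L' := IHm s sm L'.
have sqm : (size (map (quo_line b) s) < m)%N by rewrite size_map.
have IHq L' := IHm _ sqm L'.
(* Zero vectors do occur, as projections of earlier vectors; they leave the span unchanged. *)
have [b0|b0] := eqVneq b 0.
  rewrite b0 span_cons add0v (le_trans (IHs L))// ler_nat.
  by rewrite fsubset_leq_card// /add_vec fsubsetUl.
(* It remains to gain one factor [w k] over exponent [d], which both the tail and its projection
   still reach. *)
have [d dE] : exists d, \dim <<b :: s>>%VS = d.+1.
  exists (\dim <<b :: s>>%VS).-1; rewrite prednK// lt0n dimv_eq0.
  by apply: contraNneq b0 => s0; rewrite -memv0 -s0 memv_span ?mem_head.
have ds : (d <= \dim <<s>>%VS)%N.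
  rewrite -ltnS -dE span_cons (leq_trans (dimv_add_leqif _ _).1)//.
  by rewrite dim_vline b0.
have dq : (d <= \dim <<map (quo_line b) s>>%VS)%N.
  rewrite -ltnS -dE (leq_trans (dim_quo_line b _))// ltnS limg_span /=.
  by rewrite span_cons quo_line_id add0v.
have := card_add_vec charF
  (foldr add_vec (list_sums L k) s) b0 (quo_line_id b).
rewrite -(ler_nat rat); apply: le_trans.
rewrite natrD imfset_foldr_add_vec imfset_list_sums.
have wk d' : (d <= d')%N -> w k ^+ d <= w k ^+ d'.
  by move=> ?; rewrite ler_weXn2l// succ_ratio_ge1.
have IHs' := le_trans (ler_wpM2l (bound_ge0 L) (wk _ ds)) (IHs L).
have IHq' := le_trans (ler_wpM2l (bound_ge0 _) (wk _ dq))
  (IHq (map (quo_line b) \o L)).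
apply: le_trans (lerD IHs' IHq').
rewrite dE exprSr mulrA -mulrDl [X in X <= _]mulrAC ler_wpM2r//.
  by rewrite exprn_ge0// (le_trans ler01)// succ_ratio_ge1.
(* The set itself supplies the 1; its projection supplies the [k.+1%:R^-1], by [bound_quo_line]. *)
have -> : w k = 1 + k.+1%:R^-1.
  by rewrite -[k.+2]addn1 natrD mulrDl mulfV ?mul1r// pnatr_eq0.
rewrite mulrDr mulr1 lerD2l ler_pdivrMr ?ltr0n// mulrC.
exact: bound_quo_line.
Qed.

Lemma card_list_sums k (L : nat -> seq vT) :
  bound L k <= #|` list_sums L k|%:R.
Proof.
elim: k L => [|k IHk] L; first by rewrite big_ord0 /= cardfs1.
by rewrite big_ord_recr /=; exact: card_foldr_add_vec.
Qed.

End ListSums.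

(** * Coordinates on the span of a finite set *)

Section Coordinates.
Variables (F : fieldType) (V : lmodType F) (A : {fset V}).

Definition lin_comb (v : 'rV[F]_#|` A|) : V :=
  \sum_(i < #|` A|) v 0 i *: nth 0 (enum_fset A) i.

Lemma lin_comb_is_linear : linear lin_comb.
Proof.
move=> a u v; rewrite /lin_comb scaler_sumr -big_split /=.
by apply: eq_bigr => i _; rewrite !mxE scalerDl scalerA.
Qed.

HB.instance Definition _ :=
  GRing.isLinear.Build F _ V _ lin_comb lin_comb_is_linear.

Lemma lin_comb_row (c : V -> F) :
  lin_comb (\row_i c (nth 0 (enum_fset A) i)) = \sum_(a <- A) c a *: a.
Proof.
rewrite (big_nth 0) big_mkord.
by apply: eq_bigr => i _; rewrite mxE.
Qed.

Lemma lin_comb_surj x : lspan [set` A] x -> exists v, lin_comb v = x.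
Proof. by move=> /lspan_fset[c ->]; eexists; exact: lin_comb_row. Qed.

Lemma lin_comb_inj : lfree [set` A] -> injective lin_comb.
Proof.
move=> /lfree_fset freeA; apply: raddf_inj => v v0.
(* Coordinates become a function on [V]: [index] recovers the position of a vector in the
   duplicate-free enumeration. *)
pose c a := if insub (index a (enum_fset A)) is Some i then v 0 i else 0.
have cE (i : 'I_#|` A|) : c (nth 0 (enum_fset A) i) = v 0 i.
  by rewrite /c index_uniq ?fset_uniq// valK.
apply/rowP => i; rewrite -cE mxE; apply: freeA; last exact: mem_nth.
rewrite -lin_comb_row -[RHS]v0; congr lin_comb.
by apply/rowP => j; rewrite mxE cE.
Qed.

End Coordinates.

(** As [s] has no repetitions, each vector is used at most once and the chosen ones form a genuine
    finite set. *)
Lemma mem_foldr_add_vec (V W : zmodType) (f : V -> W) (X : {fset W})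
    (s : seq V) x :
  uniq s -> x \in foldr add_vec X [seq f b | b <- s] ->
  exists C : {fset V}, {subset C <= s} /\
    exists2 y, y \in X & x = y + \sum_(b <- C) f b.
Proof.
elim: s x => [|b s IHs] x /=.
  move=> _ xX; exists fset0; split=> //; exists x => //.
  by rewrite big_seq_fset0 addr0.
move=> /andP[bs us]; rewrite /add_vec inE => /orP[|/imfsetP[/= z zX ->]].
  move=> /(IHs _ us)[C [Cs [y yX ->]]]; exists C; split; last by exists y.
  by move=> c /Cs; rewrite inE orbC => ->.
have [C [Cs [y yX ->]]] := IHs _ us zX.
exists (b |` C)%fset; split.
  by move=> c; rewrite !inE => /orP[->//|/Cs ->]; rewrite orbT.
exists y => //; rewrite big_fsetU1/= ?addrA; last by apply: contra bs => /Cs.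
by rewrite addrAC.
Qed.

(** * Transport of ranks and sums along a linear map *)

Section Transport.
Variables (F : fieldType) (V : lmodType F) (vT : vectType F).
Variable g : {linear vT -> V}.

(** The image under [g] of a basis of [<<s>>] spans [B], so independent vectors in the span of [B]
    cannot outnumber that basis. *)
Lemma rk_le_dim (B : set V) (s : seq vT) :
  finite_set B -> (forall b, B b -> exists2 v, v \in s & g v = b) ->
  (rk B <= \dim <<s>>%VS)%N.
Proof.
move=> finB Bs; have /has_dimP[A [freeA spanA <-]] := has_dim_rk finB.
pose X := vbasis <<s>>%VS; pose C := [fset g x | x in tval X]%fset.
apply: (@leq_trans #|` C|); last first.
  rewrite (leq_trans (leq_imfset_card _ _ _))//=.
  by rewrite (leq_trans (size_undup _))// size_tuple.
apply: leq_lfree_lspan => // a Aa.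
have : lspan B a by rewrite -spanA; exact: sub_lspan.
apply: lspan_fset_sub => _ /Bs[v vs <-].
have vX : v \in <<X>>%VS by rewrite (span_basis (vbasisP _)) memv_span.
rewrite (coord_span vX) linear_sum.
have span_sum n (y : 'I_n -> V) : (forall i, lspan [set` C] (y i)) ->
    lspan [set` C] (\sum_i y i).
  move=> yC; have /choice[c cE] i : exists c, y i = \sum_(a <- C) c a *: a.
    exact/lspan_fset.
  apply/lspan_fset.
  exists (fun a => \sum_i c i a); under eq_bigr do rewrite cE.
  by rewrite exchange_big; apply: eq_bigr => ? _; rewrite scaler_suml.
apply: span_sum => i; rewrite linearZ /=.
exists [fset g X`_i]%fset, (fun=> coord X i v); split; last first.
  by rewrite big_seq_fset1.
move=> y /=; rewrite inE => /eqP ->; apply/imfsetP; exists X`_i => //=.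
by rewrite mem_nth// size_tuple.
Qed.

Lemma list_sums_sub_sumset k (B : 'I_k -> set V) (f : V -> vT)
    (L : nat -> seq V) x :
  (forall i, uniq (L i)) -> (forall i : 'I_k, {subset L i <= B i}) ->
  (forall (i : 'I_k) b, b \in L i -> g (f b) = b) ->
  x \in list_sums (map f \o L) k ->
  sumset (fun i => subset_sums (B i)) (g x).
Proof.
move=> uL LB gf xL.
(* Indexing [y] by [nat] lets the induction on [k] simply redefine it at the new last index. *)
suff [y [yB gx]] : exists y : nat -> V,
    (forall i : 'I_k, subset_sums (B i) (y i)) /\ g x = \sum_(i < k) y i.
  by exists (fun i => y i); split.
elim: k B LB gf x xL => [|k IHk] B LB gf x /=.
  rewrite inE => /eqP ->; exists (fun=> 0); split; first by case.
  by rewrite big_ord0 linear0.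
move=> /(mem_foldr_add_vec (uL k))[C [CL [z zL ->]]].
have [i|i b|y [yB gz]] := IHk (fun i => B (widen_ord (leqnSn k) i)) _ _ z zL.
- exact: (LB (widen_ord (leqnSn k) i)).
- exact: (gf (widen_ord (leqnSn k) i)).
have gC : g (\sum_(b <- C) f b) = \sum_(b <- C) b.
  rewrite linear_sum !big_seq; apply: eq_bigr => b /CL bL.
  exact: (gf ord_max).
exists (fun i => if i == k then \sum_(b <- C) b else y i); split=> [i|].
  have [ik|ik] := eqVneq (i : nat) k.
    have -> : i = ord_max by exact: val_inj.
    by exists C; split=> // b /CL/(LB ord_max); rewrite inE.
  have ltik : (i < k)%N by rewrite ltn_neqAle ik -ltnS ltn_ord.
  have -> : i = widen_ord (leqnSn k) (Ordinal ltik) by exact: val_inj.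
  exact: yB (Ordinal ltik).
rewrite linearD gz gC big_ord_recr /= eqxx; congr (_ + _).
by apply: eq_bigr => i _; rewrite ltn_eqF.
Qed.

End Transport.

(** * Arbitrary vector spaces, and bases *)

Section CharZero.
Variables (F : fieldType) (charF : [pchar F] =i pred0) (V : lmodType F).

(** A basis of the span of the union of all [B i] gives one coordinate space for all of them; the
    list bound holds there and the injective [g] carries it back. *)
Lemma card_sumset_ge k (B : 'I_k -> set V) : (forall i, finite_set (B i)) ->
  (\prod_(i < k) (i.+2%:R / i.+1%:R) ^+ rk (B i) : rat)
    <= #|` fset_set (sumset (fun i => subset_sums (B i)))|%:R.
Proof.
move=> finB; pose U := \bigcup_(i in [set: 'I_k]) B i.
have finU : finite_set U by apply: bigcup_finite => //; exact: finite_finset.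
have /has_dimP[A [freeA spanA _]] := has_dim_rk finU.
pose g := @lin_comb F V A : {linear _ -> _}.
have /choice[f fE] b : exists v, U b -> g v = b.
  have [Ub|nUb] := pselect (U b); last by exists 0.
  have [|v <-] := @lin_comb_surj F V A b; last by exists v.
  by rewrite spanA; exact: sub_lspan.
(* Indices from [k] on get the empty list, which keeps [uL] true for every [i]. *)
pose L i : seq V := if insub i is Some j then fset_set (B j) else [::].
have LE (i : 'I_k) b : (b \in L i) = (b \in B i).
  by rewrite /L valK in_fset_set.
have uL i : uniq (L i) by rewrite /L; case: insub => //= j; exact: fset_uniq.
have gf (i : 'I_k) b : b \in L i -> g (f b) = b.
  by rewrite LE inE => Bb; apply: fE; exists i.
have finS : finite_set (sumset (fun i => subset_sums (B i))).
  by apply: finite_sumset => i; exact: finite_subset_sums.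
apply: (@le_trans _ _ (#|` list_sums (map f \o L) k|%:R)).
  apply: le_trans (card_list_sums charF _ _); apply: ler_prod => i _.
  rewrite exprn_ge0 ?(le_trans ler01 (succ_ratio_ge1 _))//=.
  rewrite ler_weXn2l ?succ_ratio_ge1//; apply: (@rk_le_dim _ _ _ g) => // b Bb.
  have bL : b \in L i by rewrite LE inE.
  by exists (f b); [exact: map_f|exact: gf bL].
rewrite ler_nat.
have <- : #|` [fset g x | x in list_sums (map f \o L) k]%fset| =
    #|` list_sums (map f \o L) k|.
  by rewrite card_imfset//; exact: lin_comb_inj freeA.
apply/fsubset_leq_card/fsubsetP => _ /imfsetP[/= x xL ->].
rewrite in_fset_set// inE; apply: (list_sums_sub_sumset (g := g) uL _ gf xL).
by move=> i b; rewrite LE.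
Qed.

(** An infinite free set would contain more than [n] independent vectors in the span of [n]
    vectors. *)
Lemma finite_basis n (B : set V) :
  has_dim [set: V] n -> is_basis [set: V] B -> finite_set B.
Proof.
move=> /has_dimP[A [_ spanA cardA]] [freeB _]; apply: contrapT => infB.
have [C CB] := infinite_set_fset n.+1 infB; rewrite -cardA ltnNge => /negP.
apply; apply: leq_lfree_lspan; last by rewrite spanA.
by move=> X c XC; apply: freeB; exact: subset_trans CB.
Qed.

Lemma rk_basis n (B : set V) :
  has_dim [set: V] n -> is_basis [set: V] B -> rk B = n.
Proof.
move=> dimV basB; apply: (has_dim_unique _ dimV).
by case: (basB) => _ <-; apply: has_dim_rk; exact: finite_basis dimV basB.
Qed.

End CharZero.

Unset Implicit Arguments.

Theorem theorem2 (F : fieldType) (charF : [pchar F] =i pred0)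
    (V : lmodType F) (k : nat) (k_gt0 : (0 < k)%N) :
  (forall B : 'I_k -> set V,
     (forall i, finite_set (B i)) -> (forall i, B i !=set0) ->
     (\prod_(i < k) (i.+2%:R / i.+1%:R) ^+ rk (B i) : rat)
       <= #|` fset_set (sumset (fun i => subset_sums (B i)))|%:R)
  /\
  (forall (n : nat) (B : 'I_k -> set V),
     has_dim [set: V] n -> (forall i, is_basis [set: V] (B i)) ->
     (k.+1 ^ n <= #|` fset_set (sumset (fun i => subset_sums (B i)))|)%N).
Proof.
split=> [B finB _|n B dimV basB]; first exact: card_sumset_ge.
(* [k.+1 ^ n] is the telescoped product with every rank equal to [n]. *)
rewrite -(ler_nat rat) natrX -prod_succ_ratio -prodrXl.
have finB i : finite_set (B i) := finite_basis dimV (basB i).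
apply: le_trans (card_sumset_ge charF finB).
apply: ler_prod => i _.
by rewrite (rk_basis dimV (basB i)) lexx andbT exprn_ge0// divr_ge0.
Qed.
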